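(* Let $k$ be a field, $V$ a $k$-vector space, $\mathcal H=T(V)$ and $\mathcal H^+=\bigoplus_{n\ge 1}V^{\otimes n}$. The dendriform products $\vee:\mathcal H\otimes\mathcal H^+\to\mathcal H^+$ and $\succ:\mathcal H\otimes\mathcal H^+\to\mathcal H^+$ of the shuffle quadri-algebra define two module-algebra structures, over the bialgebra $(\mathcal H,\sqcup\!\sqcup,\Delta)$, on the (non-unital) algebra $(\mathcal H^+,m)$, where $m$ is concatenation and $\Delta$ is deconcatenation; i.e., as maps $\mathcal H\otimes\mathcal H^+\otimes\mathcal H^+\to\mathcal H^+$, $$m\circ(\vee\otimes\vee)\circ\tau_{23}\circ(\Delta\otimes I\otimes I)=\vee\circ(I\otimes m),$$ $$m\circ(\succ\otimes\succ)\circ\tau_{23}\circ(\Delta\otimes I\otimes I)=\succ\circ(I\otimes m).$$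
   Context: $\mathcal H=T(V)=\bigoplus_{n\ge0}V^{\otimes n}$, with empty word $\mathbf 1$ spanning $V^{\otimes 0}=k$. Words (pure tensors) are written $u=u_1\cdots u_p$ with $u_i\in V$. $m(u\otimes v)=uv$ is concatenation. The deconcatenation coproduct is $\Delta(u)=\sum_{u=u^1u^2}u^1\otimes u^2$; for a word $u$ of length $p$ the sum runs over all $p+1$ ways of cutting $u$ into a prefix $u^1$ and a suffix $u^2$ (each possibly equal to $\mathbf 1$). $\tau_{23}$ exchanges the second and third tensor factors, and $I$ is the identity. Module-algebra: given a bialgebra $(B,\cdot,\Delta)$ and a (not necessarily unital) associative algebra $(A,m)$, a module-algebra structure is a left $(B,\cdot)$-module structure $\Phi:B\otimes A\to A$ satisfying $\Phi\circ(I\otimes m)=m\circ(\Phi\otimes\Phi)\circ\tau_{23}\circ(\Delta\otimes I\otimes I)$. Let $\mathrm{Sh}(p,q)$ be the set of permutations $\sigma\in S_{p+q}$ with $\sigma(1)<\cdots<\sigma(p)$ and $\sigma(p+1)<\cdots<\sigma(p+q)$. For $u=u_1\cdots u_p$ and $v=u_{p+1}\cdots u_{p+q}$, the shuffle product is $u\sqcup\!\sqcup v=\sum_{\sigma\in\mathrm{Sh}(p,q)}u_{\sigma^{-1}(1)}\cdots u_{\sigma^{-1}(p+q)}$, extended bilinearly; $\mathbf 1$ is its unit, and $(\mathcal H,\sqcup\!\sqcup,\Delta)$ is a bialgebra. Quadri-algebra operations. For $p,q\ge1$, $u=u_1\cdots u_p$ and $v=u_{p+1}\cdots u_{p+q}$,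 each of the four bilinear operations is given by $\sum_\sigma u_{\sigma^{-1}(1)}\cdots u_{\sigma^{-1}(p+q)}$, the sum being over the $\sigma\in\mathrm{Sh}(p,q)$ such that: - for $u\searrow v$: $\sigma^{-1}(1)=p+1$ and $\sigma^{-1}(p+q)=p+q$ (first letter and last letter both come from $v$); - for $u\nearrow v$: $\sigma^{-1}(1)=p+1$ and $\sigma^{-1}(p+q)=p$ (first letter from $v$, last letter from $u$); - for $u\nwarrow v$: $\sigma^{-1}(1)=1$ and $\sigma^{-1}(p+q)=p$ (first and last letters from $u$); - for $u\swarrow v$: $\sigma^{-1}(1)=1$ and $\sigma^{-1}(p+q)=p+q$ (first letter from $u$, last letter from $v$). An empty sum is $0$. For $a\in\mathcal H^+$ one sets $\mathbf 1\searrow a=a$, $\mathbf 1\nearrow a=\mathbf 1\nwarrow a=\mathbf 1\swarrow a=0$, and $a\nwarrow\mathbf 1=a$, $a\nearrow\mathbf 1=a\searrow\mathbf 1=a\swarrow\mathbf 1=0$. In particular all operations are defined as linear maps $\mathcal H\otimes\mathcal H^+\to\mathcal H^+$. Derived operations used here: $x\succ y=x\nearrow y+x\searrow y$ and $x\vee y=x\searrow y+x\swarrow y$. *)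

(* Defs.v *)
From HB Require Import structures.
From mathcomp Require Import all_boot all_order all_fingroup all_algebra.
From mathcomp Require Import boolp generic_quotient.
From mathcomp Require Import freeg.

Set Implicit Arguments.
Unset Strict Implicit.
Unset Printing Implicit Defensive.

Import GRing.Theory.
Local Open Scope ring_scope.
Local Open Scope quotient_scope.

Reserved Notation "M ⊗ N" (at level 35, right associativity).
Reserved Notation "x ⊗t y" (at level 35, right associativity).

Section LinearSpan.
Variables (k : fieldType) (U : lmodType k) (R : U -> Prop).

Inductive lspan : U -> Prop :=
| lspan0 : lspan 0
| lspanP a r u : R r -> lspan u -> lspan (a *: r + u).

Lemma lspan_gen r : R r -> lspan r.
Proof. by move=> Rr; rewrite -[r]scale1r -[_ *: r]addr0; do ?constructor. Qed.

Lemma lspanD u v : lspan u -> lspan v -> lspan (u + v).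
Proof.
move=> + Sv; elim=> [|a r w Rr _ IH]; first by rewrite add0r.
by rewrite -addrA; constructor.
Qed.

Lemma lspanZ a u : lspan u -> lspan (a *: u).
Proof.
elim=> [|b r w Rr _ IH]; first by rewrite scaler0; constructor.
by rewrite scalerDr scalerA; constructor.
Qed.

Definition in_lspan : {pred U} := fun u => `[< lspan u >].

Lemma in_lspanP u : reflect (lspan u) (u \in in_lspan).
Proof. exact: asboolP. Qed.

Fact in_lspan_submod : submod_closed in_lspan.
Proof.
split; first by apply/in_lspanP; constructor.
move=> a u v /in_lspanP Su /in_lspanP Sv; apply/in_lspanP.
by apply: lspanD => //; apply: lspanZ.
Qed.

HB.instance Definition _ := GRing.isSubmodClosed.Build k U in_lspan in_lspan_submod.

End LinearSpan.

(* The quotient of [U] by the span of [R]; membership in the span is made boolean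
   classically. *)
Section LinearQuotient.
Variables (k : fieldType) (U : lmodType k) (R : U -> Prop).

Definition lquot := Quotient.quot (in_lspan R).
HB.instance Definition _ := GRing.Zmodule.on lquot.
HB.instance Definition _ := EqQuotient.on lquot.

Definition lpi (u : U) : lquot := \pi_lquot u.

Lemma lpiP u v : lpi u = lpi v <-> lspan R (u - v).
Proof.
split=> [/eqP|/in_lspanP]; first by rewrite -Quotient.idealrBE => /in_lspanP.
by rewrite Quotient.idealrBE => /eqP.
Qed.

Lemma lpiK (x : lquot) : lpi (repr x) = x.
Proof. exact: reprK. Qed.

Lemma lpiD u v : lpi (u + v) = lpi u + lpi v.
Proof. by rewrite /lpi !piE. Qed.

Definition lscale (a : k) (x : lquot) : lquot := lpi (a *: repr x).

Lemma lpiZ a u : lpi (a *: u) = lscale a (lpi u).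
Proof.
apply/lpiP; rewrite -scalerBr; apply: lspanZ; apply/lpiP.
by rewrite lpiK.
Qed.

Fact lscaleA a b x : lscale a (lscale b x) = lscale (a * b) x.
Proof. by rewrite -[x]lpiK -!lpiZ scalerA. Qed.
Fact lscale1 : left_id 1 lscale.
Proof. by move=> x; rewrite -[x]lpiK -!lpiZ scale1r. Qed.
Fact lscaleDr : right_distributive lscale +%R.
Proof.
by move=> a x y; rewrite -[x]lpiK -[y]lpiK -lpiD -!lpiZ scalerDr lpiD.
Qed.
Fact lscaleDl x : {morph lscale^~ x : a b / a + b}.
Proof. by move=> a b; rewrite -[x]lpiK -!lpiZ scalerDl lpiD. Qed.

HB.instance Definition _ :=
  GRing.Zmodule_isLmodule.Build k lquot lscaleA lscale1 lscaleDr lscaleDl.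

Fact lpi_linear : linear lpi.
Proof. by move=> a u v; rewrite lpiD lpiZ. Qed.
HB.instance Definition _ := GRing.isLinear.Build k U lquot _ lpi lpi_linear.

End LinearQuotient.


Section Presentation.
Variables (k : fieldType) (X : choiceType) (R : {freeg X / k} -> Prop).

Definition gen (x : X) : lquot R := lpi R << x >>.

Lemma gen_ind (Q : lquot R -> Prop) :
  Q 0 -> (forall a x u, Q u -> Q (a *: gen x + u)) -> forall u, Q u.
Proof.
move=> Q0 QS u; rewrite -[u]lpiK; elim/freeg_ind_dom0: (repr u).
  by rewrite linear0.
move=> a x D _ _; rewrite linearD /=.
suff ->: << a *g x >> = a *: << x >> :> {freeg X / k}.
  by rewrite linearZ; apply: QS.
by apply/eqP/freeg_eqP => y; rewrite coeffZ !coeffU mul1r.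
Qed.

Section Lift.
Variables (P : lmodType k) (f : X -> P).

Fact fglift_linear : linear (fglift f).
Proof.
have fB := @lift_is_additive k X P f.
have f0 : fglift f 0 = 0 by rewrite -(subrr (0 : {freeg X / k})) fB subrr.
have fD u v : fglift f (u + v) = fglift f u + fglift f v.
  by rewrite -{1}[v]opprK fB -[- v]add0r fB f0 sub0r opprK.
move=> a u v; rewrite fD; congr (_ + _).
elim/freeg_ind_dom0: u => [|b x D _ _ IH].
  by rewrite scaler0 f0 scaler0.
rewrite scalerDr !fD IH scalerDr; congr (_ + _).
suff ->: a *: << b *g x >> = << a * b *g x >> :> {freeg X / k}.
  by rewrite !liftU scalerA.
by apply/eqP/freeg_eqP => y; rewrite coeffZ !coeffU mulrA.
Qed.
HB.instance Definition _ := GRing.isLinear.Build k _ P _ (fglift f) fglift_linear.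

Lemma fglift1 x : fglift f << x >> = f x.
Proof. by rewrite liftU scale1r. Qed.

(* The linear extension of [f] to the presented module; it is meaningful only
   when [f] satisfies the relations, see [pres_lift_gen]. *)
Definition pres_lift (x : lquot R) : P := fglift f (repr x).

Definition respects := forall r, R r -> fglift f r = 0.
Hypothesis fR : respects.

Lemma pres_lift_lpi u : pres_lift (lpi R u) = fglift f u.
Proof.
apply/eqP; rewrite -subr_eq0 -linearB; apply/eqP => /=.
have/lpiP: lpi R (repr (lpi R u)) = lpi R u by exact: lpiK.
by elim=> [|a r v Rr _ IH]; rewrite ?linear0 // linearP /= IH fR // scaler0 add0r.
Qed.

Lemma pres_lift_gen x : pres_lift (gen x) = f x.
Proof. by rewrite pres_lift_lpi fglift1. Qed.

Lemma pres_lift_linear : linear pres_lift.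
Proof.
move=> a u v; rewrite -[u]lpiK -[v]lpiK -linearP !pres_lift_lpi.
by rewrite linearP.
Qed.
End Lift.
End Presentation.

Section TensorProduct.
Variables (k : fieldType) (M N : lmodType k).

Inductive tens_rel : {freeg (M * N)%type / k} -> Prop :=
| tens_relL a x x' y :
    tens_rel (<< (a *: x + x', y) >> - (a *: << (x, y) >> + << (x', y) >>))
| tens_relR a x y y' :
    tens_rel (<< (x, a *: y + y') >> - (a *: << (x, y) >> + << (x, y') >>)).

(* The tensor product, as the free module on M * N modulo bilinearity *)
Definition tens := lquot tens_rel.
HB.instance Definition _ := GRing.Lmodule.on tens.

Definition tpure (x : M) (y : N) : tens := gen tens_rel (x, y).

Definition bilin (P : lmodType k) (f : M -> N -> P) :=
  (forall y, linear (f^~ y)) /\ (forall x, linear (f x)).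

Lemma tpure_bilin : bilin tpure.
Proof.
split=> [y a x x'|x a y y']; rewrite /tpure /gen; apply/esym;
  (etransitivity; first by apply/esym/linearP); apply/esym/lpiP/lspan_gen.
  exact: tens_relL.
exact: tens_relR.
Qed.

Lemma tens_ind (Q : tens -> Prop) :
  Q 0 -> (forall x y u, Q u -> Q (tpure x y + u)) -> forall u, Q u.
Proof.
move=> Q0 QS; apply: gen_ind => // a [x y] u Qu.
suff ->: a *: gen tens_rel (x, y) = tpure (a *: x) y by exact: QS.
have [/(_ y a x 0) L _] := tpure_bilin.
have [/(_ y (-1) 0 0) L0 _] := tpure_bilin.
rewrite /= scaler0 addr0 scaleN1r addNr in L0.
by rewrite /= addr0 L0 addr0 in L.
Qed.

Section TensorLift.
Variables (P : lmodType k) (f : M -> N -> P).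

Definition tlift : tens -> P := pres_lift (R := tens_rel) (fun xy => f xy.1 xy.2).

Hypothesis fb : bilin f.

Fact tlift_respects : respects tens_rel (fun xy => f xy.1 xy.2).
Proof.
case: fb => fl fr r [a x x' y|a x y y'];
  by rewrite linearB linearP /= !fglift1 ?(fl y) ?(fr x) subrr.
Qed.

Lemma tlift_linear : linear tlift.
Proof. exact: pres_lift_linear tlift_respects. Qed.

Lemma tliftE x y : tlift (tpure x y) = f x y.
Proof. exact: (pres_lift_gen tlift_respects (x, y)). Qed.
End TensorLift.

End TensorProduct.

Notation "M ⊗ N" := (tens M N) : type_scope.
Notation "x ⊗t y" := (tpure x y) : ring_scope.

Section TensorLiftParam.
Variables (k : fieldType) (M N C P : lmodType k) (f : C -> M -> N -> P).
Hypothesis fb : forall c, bilin (f c).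
Hypothesis fc : forall x y, linear (fun c => f c x y).

Lemma tlift_param t : linear (fun c => tlift (f c) t).
Proof.
move=> a c d /=; elim/tens_ind: t => [|x y u IH].
  have L c' := tlift_linear (fb c').
  have L0 c' : tlift (f c') 0 = 0.
    have := L c' (-1) 0 0; rewrite scaler0 addr0 => ->.
    by rewrite scaleN1r addNr.
  by rewrite !L0 scaler0 addr0.
have L c' v : tlift (f c') (x ⊗t y + v) = f c' x y + tlift (f c') v.
  by rewrite -[x ⊗t y]scale1r (tlift_linear (fb c')) scale1r tliftE.
by rewrite !L IH fc scalerDr addrACA.
Qed.

Lemma bilin_tlift : bilin (fun c => tlift (f c)).
Proof. by split; [exact: tlift_param | move=> c; apply: tlift_linear]. Qed.
End TensorLiftParam.

Section TensorMaps.
Variable k : fieldType.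
Implicit Types A B C D : lmodType k.

Lemma tpurel A B (y : B) : linear (fun x : A => x ⊗t y).
Proof. exact: (tpure_bilin A B).1. Qed.
Lemma tpurer A B (x : A) : linear (fun y : B => x ⊗t y).
Proof. exact: (tpure_bilin A B).2. Qed.

Section TMap.
Variables (A B C D : lmodType k) (f : {linear A -> C}) (g : {linear B -> D}).
Definition tmap : A ⊗ B -> C ⊗ D := tlift (fun x y => f x ⊗t g y).
Fact tmap_bilin : bilin (fun x y => f x ⊗t g y).
Proof. by split=> [y|x] a u v /=; rewrite linearP (tpurel, tpurer). Qed.
HB.instance Definition _ := GRing.isLinear.Build k _ _ _ tmap (tlift_linear tmap_bilin).
Lemma tmapE x y : tmap (x ⊗t y) = f x ⊗t g y.
Proof. exact: (tliftE tmap_bilin). Qed.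
End TMap.

Section Tau.
Variables (A B C D : lmodType k).
Definition tau23 : (A ⊗ B) ⊗ (C ⊗ D) -> (A ⊗ C) ⊗ (B ⊗ D) :=
  tlift (fun s => tlift (fun c d => tlift (fun a b => (a ⊗t c) ⊗t (b ⊗t d)) s)).

Fact tau23_bilin0 c d :
  bilin (fun (a : A) (b : B) => (a ⊗t c : A ⊗ C) ⊗t (b ⊗t d : B ⊗ D)).
Proof.
split=> [b|a] x u v /=.
  by rewrite (tpurel c) (tpurel (b ⊗t d)).
by rewrite (tpurel d) (tpurer (a ⊗t c)).
Qed.
Fact tau23_bilin1 s :
  bilin (fun (c : C) (d : D) => tlift (fun a b => (a ⊗t c : A ⊗ C) ⊗t (b ⊗t d : B ⊗ D)) s).
Proof.
split=> [d|c]; (apply: tlift_param; first by move=> ?; apply: tau23_bilin0);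
  move=> a b x u v /=.
  by rewrite (tpurer a) (tpurel (b ⊗t d)).
by rewrite (tpurer b) (tpurer (a ⊗t c)).
Qed.
Fact tau23_bilin : bilin (fun (s : A ⊗ B) => tlift (fun (c : C) (d : D) =>
  tlift (fun a b => (a ⊗t c : A ⊗ C) ⊗t (b ⊗t d : B ⊗ D)) s)).
Proof.
apply: bilin_tlift => [s|c d]; first exact: tau23_bilin1.
exact: tlift_linear (tau23_bilin0 c d).
Qed.
HB.instance Definition _ := GRing.isLinear.Build k _ _ _ tau23 (tlift_linear tau23_bilin).
Lemma tau23E a b c d : tau23 ((a ⊗t b) ⊗t (c ⊗t d)) = (a ⊗t c) ⊗t (b ⊗t d).
Proof.
rewrite /tau23 (tliftE tau23_bilin) (tliftE (tau23_bilin1 _)).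
exact: (tliftE (tau23_bilin0 c d)).
Qed.
End Tau.

Section Assoc.
Variables (A B C : lmodType k).
Definition tassoc : (A ⊗ B) ⊗ C -> A ⊗ (B ⊗ C) :=
  tlift (fun s c => tlift (fun a b => a ⊗t (b ⊗t c)) s).
Fact tassoc_bilin0 c : bilin (fun (a : A) (b : B) => a ⊗t (b ⊗t c : B ⊗ C)).
Proof.
split=> [b|a] x u v /=; first exact: (tpurel (b ⊗t c)).
by rewrite (tpurel c) (tpurer a).
Qed.
Fact tassoc_bilin :
  bilin (fun (s : A ⊗ B) (c : C) => tlift (fun a b => a ⊗t (b ⊗t c : B ⊗ C)) s).
Proof.
split=> [c|s]; first exact: tlift_linear (tassoc_bilin0 c).
apply: tlift_param => [c|a b x u v /=]; first exact: tassoc_bilin0.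
by rewrite (tpurer b) (tpurer a).
Qed.
HB.instance Definition _ := GRing.isLinear.Build k _ _ _ tassoc (tlift_linear tassoc_bilin).
Lemma tassocE a b c : tassoc ((a ⊗t b) ⊗t c) = a ⊗t (b ⊗t c).
Proof. by rewrite /tassoc (tliftE tassoc_bilin) (tliftE (tassoc_bilin0 c)). Qed.
End Assoc.
End TensorMaps.

Arguments tau23 {k} A B C D.
Arguments tassoc {k} A B C.

Section ModuleAlgebra.
Variable k : fieldType.

(* Associative, unital, coassociative and counital; the counit is determined by
   [Delta], so it is not part of the data. *)
Record is_bialgebra (B : lmodType k) (mul : {linear B ⊗ B -> B}) (one : B)
    (Delta : {linear B -> B ⊗ B}) : Prop := IsBialgebra {
  bialg_mulA : forall x y z, mul (x ⊗t mul (y ⊗t z)) = mul (mul (x ⊗t y) ⊗t z);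
  bialg_mul1 : forall x, mul (one ⊗t x) = x;
  bialg_mulr1 : forall x, mul (x ⊗t one) = x;
  bialg_coassoc :
    tassoc B B B \o tmap Delta idfun \o Delta
      =1 tmap idfun Delta \o Delta;
  bialg_counit : exists eps : {scalar B},
    [/\ forall x, tlift (fun y z => eps y *: z) (Delta x) = x,
        forall x, tlift (fun y z => eps z *: y) (Delta x) = x,
        eps one = 1 & forall x y, eps (mul (x ⊗t y)) = eps x * eps y];
  bialg_comul1 : Delta one = one ⊗t one;
  bialg_comulM :
    Delta \o mul =1 tmap mul mul \o tau23 B B B B \o tmap Delta Delta }.

(* [A] need not be unital. Triple tensors are bracketed as B ⊗ (A ⊗ A), so
   that [tmap Delta idfun] is Delta ⊗ I ⊗ I. *)
Record is_module_algebra (B : lmodType k) (mul : {linear B ⊗ B -> B}) (one : B)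
    (Delta : {linear B -> B ⊗ B}) (A : lmodType k) (m : {linear A ⊗ A -> A})
    (Phi : {linear B ⊗ A -> A}) : Prop := IsModuleAlgebra {
  modalg_bialg : is_bialgebra mul one Delta;
  modalg_mA : forall a b c, m (a ⊗t m (b ⊗t c)) = m (m (a ⊗t b) ⊗t c);
  modalg_act1 : forall a, Phi (one ⊗t a) = a;
  modalg_actM : forall x y a, Phi (mul (x ⊗t y) ⊗t a) = Phi (x ⊗t Phi (y ⊗t a));
  modalg_compat :
    Phi \o tmap idfun m
      =1 m \o tmap Phi Phi \o tau23 B B A A \o tmap Delta idfun }.
End ModuleAlgebra.

Section TensorAlgebra.
Variables (k : fieldType) (V : lmodType k).

Inductive talg_rel : {freeg (seq V) / k} -> Prop :=
  TalgRel (s t : seq V) a x y :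
    talg_rel (<< s ++ (a *: x + y) :: t >>
              - (a *: << s ++ x :: t >> + << s ++ y :: t >>)).

(* The relations only involve words of one and the same length, so the quotient
   is the direct sum of the V^{⊗ n}, each presented by the words of length n. *)
Definition talg := lquot talg_rel.
HB.instance Definition _ := GRing.Lmodule.on talg.

Definition word (s : seq V) : talg := gen talg_rel s.

Definition multilinear (P : lmodType k) (f : seq V -> P) :=
  forall s t a x y,
    f (s ++ (a *: x + y) :: t) = a *: f (s ++ x :: t) + f (s ++ y :: t).

Lemma word_multilinear : multilinear word.
Proof.
move=> s t a x y; rewrite /word /gen; apply/esym.
by etransitivity; [apply/esym/linearP | apply/esym/lpiP/lspan_gen].
Qed.

Lemma talg_ind (Q : talg -> Prop) :
  Q 0 -> (forall a s u, Q u -> Q (a *: word s + u)) -> forall u, Q u.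
Proof. exact: gen_ind. Qed.

Section Lift.
Variables (P : lmodType k) (f : seq V -> P).

Definition wlift : talg -> P := pres_lift (R := talg_rel) f.

Hypothesis fm : multilinear f.

Fact wlift_respects : respects talg_rel f.
Proof. by move=> _ [s t a x y]; rewrite linearB linearP /= !fglift1 fm subrr. Qed.

Lemma wlift_linear : linear wlift.
Proof. exact: pres_lift_linear wlift_respects. Qed.

Lemma wliftE s : wlift (word s) = f s.
Proof. exact: (pres_lift_gen wlift_respects). Qed.

Lemma wlift0 : wlift 0 = 0.
Proof.
by have := wlift_linear (-1) 0 0; rewrite scaler0 addr0 scaleN1r addNr.
Qed.

Lemma wliftP a s u : wlift (a *: word s + u) = a *: f s + wlift u.
Proof. by rewrite wlift_linear wliftE. Qed.
End Lift.

Lemma wlift_param (C P : lmodType k) (f : C -> seq V -> P) :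
  (forall c, multilinear (f c)) -> (forall s, linear (f^~ s)) ->
  forall u, linear (fun c => wlift (f c) u).
Proof.
move=> fm fc u a c d; elim/talg_ind: u => [|b s u IH].
  by rewrite !wlift0 // scaler0 addr0.
by rewrite !wliftP // IH fc !scalerDr !scalerA addrACA (mulrC a b).
Qed.

(* The bilinear extension of an operation on words, and its two-sided
   multilinearity. *)
Definition multilinear2 (P : lmodType k) (f : seq V -> seq V -> P) :=
  (forall t, multilinear (f^~ t)) /\ (forall s, multilinear (f s)).

Definition wlift2 (P : lmodType k) (f : seq V -> seq V -> P) (x y : talg) : P :=
  wlift (fun s => wlift (f s) y) x.

Lemma wlift2_multilinear (P : lmodType k) (f : seq V -> seq V -> P) y :
  multilinear2 f -> multilinear (fun s => wlift (f s) y).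
Proof.
move=> [fl fr] s t a u v; elim/talg_ind: y => [|b w y IH].
  by rewrite !wlift0 // scaler0 addr0.
by rewrite !wliftP // IH fl !scalerDr !scalerA addrACA (mulrC a b).
Qed.

Lemma wlift2_bilin (P : lmodType k) (f : seq V -> seq V -> P) :
  multilinear2 f -> bilin (wlift2 f).
Proof.
move=> fm; split=> [y|x]; first exact/wlift_linear/wlift2_multilinear.
apply: (wlift_param (f := fun y s => wlift (f s) y)) => [y|s].
  exact: wlift2_multilinear.
exact: wlift_linear (fm.2 s).
Qed.

Lemma wlift2E (P : lmodType k) (f : seq V -> seq V -> P) s t :
  multilinear2 f -> wlift2 f (word s) (word t) = f s t.
Proof.
by move=> fm; rewrite /wlift2 wliftE ?wliftE //; [exact: fm.2|exact: wlift2_multilinear].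
Qed.

(* [talg] restricted to the words of positive length *)
Definition tpos_gen (u : talg) := exists2 s : seq V, s != [::] & u = word s.
Definition tpos := {u : talg | u \in in_lspan tpos_gen}.
HB.instance Definition _ := SubChoice.on tpos.
HB.instance Definition _ := [SubChoice_isSubLmodule of tpos by <:].

Lemma word_pos s : s != [::] -> word s \in in_lspan tpos_gen.
Proof. by move=> s0; apply/in_lspanP/lspan_gen; exists s. Qed.

Record pos_op := PosOp {
  pos_opw :> seq V -> seq V -> talg;
  pos_op_multilinear : multilinear2 pos_opw;
  pos_op_pos : forall s t, t != [::] -> pos_opw s t \in in_lspan tpos_gen }.

Fact pos_op_subproof (f : pos_op) x (y : tpos) :
  wlift2 f x (val y) \in in_lspan tpos_gen.
Proof.
have [fl fr] := pos_op_multilinear f.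
elim/talg_ind: x => [|a s x IH]; rewrite /wlift2.
  by rewrite wlift0 ?rpred0 //; apply: wlift2_multilinear.
rewrite wliftP; last exact: wlift2_multilinear.
rewrite rpredD ?rpredZ //; case: y {IH} => y /= /in_lspanP.
elim=> [|b _ u [t t0 ->] _ IH]; first by rewrite wlift0 ?rpred0.
by rewrite wliftP // rpredD ?rpredZ // pos_op_pos.
Qed.

Definition pos_act (f : pos_op) (x : talg) (y : tpos) : tpos :=
  Sub (wlift2 f x (val y)) (pos_op_subproof f x y).

Lemma pos_act_bilin f : bilin (pos_act f).
Proof.
have [bl br] := wlift2_bilin (pos_op_multilinear f).
by split=> [y|x] a u v; apply: val_inj; rewrite linearP /= ?linearP (bl, br).
Qed.

End TensorAlgebra.

Section Shuffle.
Variables (k : fieldType) (V : lmodType k).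
Local Notation T := (talg V).
Local Notation Tp := (tpos V).

(* Sh(p, q), with 0-based positions *)
Definition is_shuffle p q (s : 'S_(p + q)) :=
  [forall i : 'I_(p + q), forall j : 'I_(p + q),
    (i < j)%N && ((j < p)%N || (p <= i)%N) ==> (s i < s j)%N].

(* the letter in (0-based) position [i] is letter number [s^-1 i] of [w] *)
Definition perm_word n (s : 'S_n) (w : seq V) : seq V :=
  [seq w`_((s^-1)%g i) | i <- enum 'I_n].

Definition perm_sum p q (Q : pred 'S_(p + q)) (w : seq V) : T :=
  \sum_(s : 'S_(p + q) | Q s) word (perm_word s w).

Lemma size_perm_word n (s : 'S_n) w : size (perm_word s w) = n.
Proof. by rewrite size_map size_enum_ord. Qed.

Lemma perm_word_multilinear n (s : 'S_n) u v a x y :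
  (size u + (size v).+1)%N = n ->
  word (perm_word s (u ++ (a *: x + y) :: v))
    = a *: word (perm_word s (u ++ x :: v)) + word (perm_word s (u ++ y :: v)).
Proof.
move=> En; have lt_u : (size u < n)%N by rewrite -En addnS ltnS leq_addr.
pose i0 := s (Ordinal lt_u).
have : i0 \in enum 'I_n by rewrite mem_enum.
move=> i0E; have := enum_uniq 'I_n.
have [l1 [l2 E]] : exists l1 l2, enum 'I_n = l1 ++ i0 :: l2.
  by case/path.splitPr: i0E => l1 l2; exists l1, l2.
rewrite E cat_uniq /= => /and3P[_ ].
rewrite negb_or => /andP[i0l1 _] /andP[i0l2 _].
have W z : perm_word s (u ++ z :: v) =
  [seq (u ++ 0 :: v)`_((s^-1)%g i) | i <- l1] ++
  z :: [seq (u ++ 0 :: v)`_((s^-1)%g i) | i <- l2].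
  have eqi (i : 'I_n) : i != i0 ->
      (u ++ z :: v)`_((s^-1)%g i) = (u ++ 0 :: v)`_((s^-1)%g i).
    move=> ne; rewrite !nth_cat; case: ltnP => // le_u.
    case E0: (_ - _)%N => [|//]; case/eqP: ne.
    rewrite /i0 -[i in LHS](permKV s); congr (s _); apply: val_inj => /=.
    by apply/eqP; rewrite eqn_leq le_u andbT -subn_eq0 E0.
  rewrite /perm_word E map_cat /= /i0 permK /= nth_cat ltnn subnn /=.
  congr (_ ++ _ :: _); apply/eq_in_map => i il; apply: eqi.
    by apply: contraNneq i0l1 => <-.
  by apply: contraNneq i0l2 => <-.
by rewrite !W word_multilinear.
Qed.

Lemma perm_sum_multilinear p q (Q : pred 'S_(p + q)) u v a x y :
  (size u + (size v).+1 = p + q)%N ->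
  perm_sum Q (u ++ (a *: x + y) :: v)
    = a *: perm_sum Q (u ++ x :: v) + perm_sum Q (u ++ y :: v).
Proof.
move=> E; rewrite scaler_sumr -big_split; apply: eq_bigr => s _ /=.
exact: perm_word_multilinear.
Qed.

Definition shuffle_word (u v : seq V) : T :=
  perm_sum (@is_shuffle (size u) (size v)) (u ++ v).

Fact shuffle_word_multilinear : multilinear2 shuffle_word.
Proof.
split=> [w|w] s t a x y; rewrite /shuffle_word !size_cat /=.
  by rewrite -!catA !cat_cons perm_sum_multilinear // size_cat -addSn addnA.
by rewrite !catA perm_sum_multilinear // size_cat addnA.
Qed.

Definition shuffle : T ⊗ T -> T := tlift (wlift2 shuffle_word).
HB.instance Definition _ := GRing.isLinear.Build k _ _ _ shuffle
  (tlift_linear (wlift2_bilin shuffle_word_multilinear)).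

Lemma shuffleE u v : shuffle (word u ⊗t word v) = shuffle_word u v.
Proof.
have M := shuffle_word_multilinear.
by rewrite /shuffle (tliftE (wlift2_bilin M)) wlift2E.
Qed.

Definition deconc_word (u : seq V) : T ⊗ T :=
  \sum_(i < (size u).+1) word (take i u) ⊗t word (drop i u).

Fact deconc_word_multilinear : multilinear deconc_word.
Proof.
move=> s t a x y; rewrite /deconc_word !size_cat /= scaler_sumr -big_split.
apply: eq_bigr => i _ /=; rewrite !take_cat !drop_cat.
case: ltnP => [_|le_si]; first by rewrite word_multilinear tpurer.
case: (i - size s)%N => [|j] /=.
  by rewrite cats0 (word_multilinear [::] t) tpurer.
by rewrite word_multilinear tpurel.
Qed.

Definition deconc : T -> T ⊗ T := wlift deconc_word.
HB.instance Definition _ := GRing.isLinear.Build k _ _ _ deconc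
  (wlift_linear deconc_word_multilinear).

Lemma deconcE u : deconc (word u) = deconc_word u.
Proof. exact: wliftE deconc_word_multilinear u. Qed.

Fact concat_word_multilinear :
  multilinear2 (fun u v : seq V => word (u ++ v)).
Proof.
split=> [w|w] s t a x y; last by rewrite !catA word_multilinear.
by rewrite -!catA !cat_cons word_multilinear.
Qed.

Fact concat_word_pos (u v : seq V) :
  v != [::] -> word (u ++ v) \in in_lspan (tpos_gen (V := V)).
Proof. by move=> v0; apply: word_pos; case: u. Qed.

Definition concat_op : pos_op V := PosOp concat_word_multilinear concat_word_pos.

Fact concat_bilin : bilin (fun x y : Tp => pos_act concat_op (val x) y).
Proof.
by split=> [y|x] a u v; rewrite ?linearP ?(pos_act_bilin _).1 ?(pos_act_bilin _).2.
Qed.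

Definition concat : Tp ⊗ Tp -> Tp := tlift (fun x y => pos_act concat_op (val x) y).
HB.instance Definition _ := GRing.isLinear.Build k _ _ _ concat
  (tlift_linear concat_bilin).

Lemma concatE (x y : Tp) u v :
  val x = word u -> val y = word v -> val (concat (x ⊗t y)) = word (u ++ v).
Proof.
move=> xu yv; rewrite /concat (tliftE concat_bilin) /= xu yv.
exact: (wlift2E _ _ concat_word_multilinear).
Qed.

(* [s^-1] sends position [i] to [j] (both 0-based) *)
Definition inv_sends n (s : 'S_n) (i j : nat) :=
  [exists a : 'I_n, (val a == i) && (val ((s^-1)%g a) == j)].

(* The shuffles whose first letter (last letter) comes from the second word if
   [fv] (if [lv]) and from the first one otherwise. *)
Definition quad_shuffle (fv lv : bool) p q (s : 'S_(p + q)) :=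
  [&& is_shuffle s,
      inv_sends s 0 (if fv then p else 0%N) &
      inv_sends s (p + q).-1 (if lv then (p + q).-1 else p.-1)].

(* The value on two empty words is irrelevant: the operation is only used with
   its second argument in [tpos]. *)
Definition quad_word (fv lv : bool) (u v : seq V) : T :=
  if nilp u && nilp v then 0
  else if nilp u then (if fv && lv then word v else 0)
  else if nilp v then (if ~~ fv && ~~ lv then word u else 0)
  else perm_sum (@quad_shuffle fv lv (size u) (size v)) (u ++ v).

Fact quad_word_multilinear fv lv : multilinear2 (quad_word fv lv).
Proof.
split=> [w|w] s t a x y; rewrite /quad_word /nilp !size_cat /= !(addnS (size s)) /=.
  case: ifP => _; last first.
    by rewrite -!catA !cat_cons perm_sum_multilinear // size_cat addnS addnA.
  by case: ifP => _; [exact: word_multilinear | rewrite scaler0 addr0].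
rewrite andbF; case: ifP => _; last first.
  by rewrite !catA perm_sum_multilinear // size_cat -addnA addnS.
by case: ifP => _; [exact: word_multilinear | rewrite scaler0 addr0].
Qed.

Fact quad_word_pos fv lv (u v : seq V) :
  v != [::] -> quad_word fv lv u v \in in_lspan (tpos_gen (V := V)).
Proof.
rewrite -size_eq0 /quad_word /nilp => /negPf v0; rewrite v0 andbF.
case: ifP => _.
  by case: ifP => _; rewrite ?rpred0 // word_pos // -size_eq0 v0.
apply: rpred_sum => s _; apply: word_pos.
by rewrite -size_eq0 size_perm_word addn_eq0 v0 andbF.
Qed.

Definition quad_op fv lv : pos_op V :=
  PosOp (quad_word_multilinear fv lv) (@quad_word_pos fv lv).

Definition quad fv lv : T ⊗ Tp -> Tp := tlift (pos_act (quad_op fv lv)).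
HB.instance Definition _ fv lv := GRing.isLinear.Build k _ _ _ (quad fv lv)
  (tlift_linear (pos_act_bilin (quad_op fv lv))).

Lemma quadE fv lv u (y : Tp) v :
  val y = word v -> val (quad fv lv (word u ⊗t y)) = quad_word fv lv u v.
Proof.
move=> yv; rewrite /quad (tliftE (pos_act_bilin (quad_op fv lv))) /= yv.
exact: (wlift2E _ _ (quad_word_multilinear fv lv)).
Qed.

(* The four quadri-algebra products ↘, ↗, ↖, ↙ *)
Definition se : {linear T ⊗ Tp -> Tp} := quad true true.
Definition ne : {linear T ⊗ Tp -> Tp} := quad true false.
Definition nw : {linear T ⊗ Tp -> Tp} := quad false false.
Definition sw : {linear T ⊗ Tp -> Tp} := quad false true.

Definition succ : {linear T ⊗ Tp -> Tp} := ne \+ se.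
Definition vee : {linear T ⊗ Tp -> Tp} := se \+ sw.

End Shuffle.

Arguments shuffle {k} V.
Arguments deconc {k} V.
Arguments concat {k} V.
Arguments succ {k} V.
Arguments vee {k} V.

(* Main.v *)
(** Write x ⧢ y for the shuffle. The last letter of x ∨ (y b) comes from y b, so
    x ∨ (y b) = (x ⧢ y) b, and likewise x ≻ (b y) = b (x ⧢ y): both operations are the
    shuffle with one letter frozen at an end, hence the action axiom is associativity
    of ⧢. A shuffle of x with y c z is cut at the letter c, which also cuts x, whence
    x ⧢ (y c z) = Σ (x¹ ⧢ y) c (x² ⧢ z) over the deconcatenations of x; appending or
    prepending the frozen letter turns this identity into either compatibility.
    Sums over shuffle permutations become sums over bit masks, bit i telling whether
    position i is filled from the second word. *)
Require Import Defs.
From HB Require Import structures.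
From mathcomp Require Import all_boot all_order all_fingroup all_algebra.
From mathcomp Require Import zify.

Set Implicit Arguments.
Unset Strict Implicit.
Unset Printing Implicit Defensive.

Import GRing.Theory.
Local Open Scope ring_scope.

(** * Bit masks with a prescribed number of set bits, and the interleaving of two words along a
    mask *)

Fixpoint masks (n q : nat) : seq bitseq :=
  if n is n'.+1 then
    [seq false :: m | m <- masks n' q] ++
    (if q is q'.+1 then [seq true :: m | m <- masks n' q'] else [::])
  else if q is 0 then [:: [::]] else [::].

Lemma mem_masks n q m : (m \in masks n q) = (size m == n) && (count id m == q).
Proof.
have I c c' m' l : (c' :: m' \in [seq c :: m0 | m0 <- l]) = (c == c') && (m' \in l).
  elim: l => [|x l IHl] /=; first by rewrite andbF.
  by rewrite !in_cons IHl eqseq_cons (eq_sym c'); case: (c == c').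
elim: n q m => [|n IH] [|q] [|b m] //=; rewrite ?cats0 ?mem_cat ?I ?IH ?eqSS.
- by apply/negP => /mapP[].
- by case: b; rewrite /= ?andbF.
- by apply/negP => /orP[] /mapP[].
- by case: b; rewrite /= ?orbF.
Qed.

Lemma masks_uniq n q : uniq (masks n q).
Proof.
have I c : injective (cons c : bitseq -> bitseq) by move=> ? ? [].
elim: n q => [|n IH] [|q] //=; rewrite ?cats0 ?cat_uniq ?map_inj_uniq ?IH //= andbT.
by apply/hasPn => _ /mapP[m _ ->]; apply/negP => /mapP[].
Qed.

Lemma masks_nil n q : (n < q)%N -> masks n q = [::].
Proof. by elim: n q => [|n IH] [|q] //= lt; rewrite !IH // ltnW. Qed.

Lemma masks0 n : masks n 0 = [:: nseq n false].
Proof. by elim: n => //= n ->. Qed.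

Lemma masksnn n : masks n n = [:: nseq n true].
Proof. by elim: n => //= n ->; rewrite masks_nil. Qed.

(** The word is cut short when the mask asks for a letter that is missing; the lemmas below
    therefore assume that the bit counts match the two lengths. *)
Fixpoint interleave (T : Type) (m : bitseq) (u v : seq T) : seq T :=
  match m, u, v with
  | true :: m', _, y :: v' => y :: interleave m' u v'
  | false :: m', x :: u', _ => x :: interleave m' u' v
  | _, _, _ => [::]
  end.

Lemma count_negb (m : bitseq) : count negb m = (size m - count id m)%N.
Proof. by rewrite -(count_predC id) addKn. Qed.

Section Interleave.
Variable T : Type.
Implicit Types (m : bitseq) (u v : seq T).

Lemma size_interleave m u v :
  count negb m = size u -> count id m = size v -> size (interleave m u v) = size m.
Proof. by elim: m u v => [|[] m IH] [|x u] [|y v] //=; rewrite ?add0n ?add1n => [] [?] [?]; rewrite ?IH. Qed.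

Lemma nth_interleave x0 m u v i :
  count negb m = size u -> count id m = size v -> (i < size m)%N ->
  nth x0 (interleave m u v) i =
    if nth false m i then nth x0 v (count id (take i m))
    else nth x0 u (count negb (take i m)).
Proof.
elim: m u v i => [|b m IH] u v [|i] //=; first by case: b u v => [] [|x u] [|y v].
by case: b u v => [] [|x u] [|y v] //=; rewrite ?add0n ?add1n => [] [?] [?] ?; rewrite IH.
Qed.

Lemma interleave_true (v : seq T) : interleave (nseq (size v) true) [::] v = v.
Proof. by elim: v => //= y v ->. Qed.

Lemma interleave_false (u : seq T) : interleave (nseq (size u) false) u [::] = u.
Proof. by elim: u => //= y v ->. Qed.

Lemma interleave_rcons m u v y :
  count negb m = size u -> count id m = size v ->
  interleave (rcons m true) u (rcons v y) = rcons (interleave m u v) y.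
Proof.
elim: m u v => [|[] m IH] [|x u] v //= E1 E2; first by case: v E2.
- by case: v E2 => [|z v] //= ?; rewrite IH //; lia.
- by case: v E2 => [|z v] //= ?; rewrite IH //; lia.
by rewrite IH //; lia.
Qed.

End Interleave.

(** * The bijection between shuffle permutations and masks *)

Section ShuffleMasks.
Variables p q : nat.
Implicit Types (s : 'S_(p + q)) (m : bitseq).

Definition shmask s : bitseq := [seq (p <= (s^-1)%g i)%N | i : 'I_(p + q)].

Lemma size_shmask s : size (shmask s) = (p + q)%N.
Proof. by rewrite size_map size_enum_ord. Qed.

Lemma nth_shmask s (i : 'I_(p + q)) : nth false (shmask s) i = (p <= (s^-1)%g i)%N.
Proof. by rewrite (nth_map i) ?size_enum_ord // nth_ord_enum. Qed.

(** Turns a count of positions into a count of letters, by reindexing along [s^-1]. It is used with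
    [a] equal to [id] or [negb], to count the letters of one block placed before position [n]. *)
Lemma count_take_shmask s (a : pred bool) (n : nat) : (n <= p + q)%N ->
  count a (take n (shmask s)) =
  #|[set j : 'I_(p + q) | (s j < n)%N && a (p <= j)%N]|.
Proof.
move=> le_n; have -> : #|[set j : 'I_(p + q) | (s j < n)%N && a (p <= j)%N]|
    = #|[set i : 'I_(p + q) | (i < n)%N && a (p <= (s^-1)%g i)%N]|.
  rewrite -[RHS](card_imset _ (@perm_inj _ (s^-1)%g)); apply: eq_card => j.
  rewrite inE; apply/idP/imsetP => [H|[i]].
    by exists (s j); rewrite ?inE ?permK.
  by rewrite inE => H ->; rewrite permKV.
elim: n le_n => [_|n IH lt_n].
  by rewrite take0; apply/esym/eqP; rewrite cards_eq0; apply/eqP/setP=> i; rewrite !inE.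
rewrite (take_nth false) ?size_shmask // -cats1 count_cat IH 1?ltnW //= addn0.
rewrite (nth_shmask s (Ordinal lt_n)).
rewrite (cardsD1 (Ordinal lt_n) [set i : 'I_(p + q) | (i < n.+1)%N && _]) inE /= ltnSn /= addnC; congr (_ + _)%N.
apply: eq_card => i; rewrite !inE ltnS -val_eqE /=.
by rewrite (leq_eqVlt i); case: (ltngtP i n) => //=.
Qed.

Lemma count_shmask s : count id (shmask s) = q.
Proof.
rewrite -[shmask s]take_size size_shmask count_take_shmask // -[RHS](card_ord q).
rewrite -[RHS](card_imset _ (@rshift_inj p q)); apply: eq_card => j.
rewrite !inE ltn_ord /=; apply/idP/imsetP => [le_p|[i _ ->]]; last exact: leq_addr.
have lt : (j - p < q)%N by have := ltn_ord j; lia.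
by exists (Ordinal lt) => //; apply: val_inj => /=; lia.
Qed.

(** A shuffle is increasing on each block, so the letters of the same block that precede the one at
    position [i] are exactly those placed before [i]. Counting them recovers [s^-1] from the
    mask. *)
Lemma shmask_inv s (i : 'I_(p + q)) : is_shuffle s ->
  (s^-1)%g i = (if nth false (shmask s) i then p + count id (take i (shmask s))
                else count negb (take i (shmask s)))%N :> nat.
Proof.
move=> /forallP sh.
(* The definition of a shuffle gives one implication; within a block the order is total, so it
   becomes an equivalence. *)
have mono (j j' : 'I_(p + q)) :
    (p <= j)%N = (p <= j')%N -> (s j < s j')%N = (j < j')%N.
  have H (l l' : 'I_(p + q)) :
      (p <= l)%N = (p <= l')%N -> (l < l')%N -> (s l < s l')%N.
    move=> E lt; have /forallP/(_ l')/implyP := sh l; apply; rewrite lt /=.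
    by case: ltnP; rewrite // -E => ->.
  move=> E; case: (ltngtP j j') => [lt|gt|/val_inj->]; rewrite ?ltnn //.
    exact: H.
  by apply/negbTE; rewrite -leqNgt ltnW // H.
rewrite nth_shmask; set j0 := (s^-1)%g i; have si: s j0 = i by rewrite permKV.
have count_iota (a b : nat) : (b <= p + q)%N ->
    #|[set j : 'I_(p + q) | (a <= j < b)%N]| = (b - a)%N.
  move=> le_b; rewrite cardE -(size_map val) -(size_iota a (b - a)).
  apply/perm_size/uniq_perm; rewrite ?iota_uniq ?(map_inj_uniq val_inj) ?enum_uniq //.
  move=> x; rewrite mem_iota; apply/mapP/idP => [[j]|H].
    by rewrite mem_enum inE => H -> /=; lia.
  have lx : (x < p + q)%N by lia.
  by exists (Ordinal lx) => //; rewrite mem_enum inE /=; lia.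
have lj := ltn_ord j0; have li := ltnW (ltn_ord i).
case: leqP => [le_p|lt_p]; rewrite count_take_shmask //.
  rewrite (_ : [set _ | _] = [set j : 'I_(p + q) | (p <= j < j0)%N]).
    by rewrite count_iota; lia.
  apply/setP => j; rewrite !inE -si andbC /=; case: (leqP p j) => //= le_j.
  by rewrite mono // le_p le_j.
rewrite (_ : [set _ | _] = [set j : 'I_(p + q) | (0 <= j < j0)%N]).
  by rewrite count_iota; lia.
apply/setP => j; rewrite !inE -si /=; case: (leqP p j) => /= le_j.
  by rewrite andbF; lia.
by rewrite andbT mono //; lia.
Qed.

Lemma shmask_inj s s' : is_shuffle s -> is_shuffle s' -> shmask s = shmask s' -> s = s'.
Proof.
move=> sh sh' E; apply: invg_inj; apply/permP => i; apply: val_inj.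
by rewrite /= !shmask_inv // E.
Qed.

(** The formula of [shmask_inv] prescribes the inverse permutation: [f] stays in range, respects the
    blocks and is increasing on each of them, hence is injective. *)
Lemma shmask_onto m : size m = (p + q)%N -> count id m = q ->
  exists2 s, is_shuffle s & shmask s = m.
Proof.
move=> sz ct; pose f i := (if nth false m i then p + count id (take i m)
   else count negb (take i m))%N.
have ctN : count negb m = p by rewrite count_negb; lia.
have bound (a : pred bool) i : (i < p + q)%N -> a (nth false m i) ->
    (count a (take i m) < count a m)%N.
  move=> lt am; rewrite -[X in (_ < count a X)%N](cat_take_drop i) count_cat.
  by rewrite (drop_nth false) ?sz //= am; lia.
have mono (a : pred bool) i j : (i < j)%N -> (j < p + q)%N -> a (nth false m i) ->
    (count a (take i m) < count a (take j m))%N.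
  move=> lt lj am; have -> : take i m = take i (take j m) by rewrite take_takel // ltnW.
  have lt' : (i < size (take j m))%N by rewrite size_take sz lj.
  rewrite -[X in (_ < count a X)%N](cat_take_drop i) count_cat (drop_nth false) //=.
  by rewrite nth_take // am; lia.
have block i : (i < p + q)%N -> (p <= f i)%N = nth false m i.
  move=> lt; rewrite /f; case E: nth; first by rewrite leq_addr.
  by have := bound negb i lt; rewrite E => /(_ isT); lia.
have flt i : (i < p + q)%N -> (f i < p + q)%N.
  move=> lt; rewrite /f; case E: nth.
    by have := bound id i lt E; lia.
  by have := bound negb i lt; rewrite E => /(_ isT); lia.
have fmono i j : (i < j)%N -> (j < p + q)%N -> nth false m i = nth false m j ->
    (f i < f j)%N.
  move=> lt lj; rewrite /f => <-; case E: nth.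
    by rewrite ltn_add2l mono.
  by apply: mono => //; rewrite E.
pose g (i : 'I_(p + q)) := Ordinal (flt i (ltn_ord i)).
have g_inj : injective g.
  move=> i j /(congr1 val) /= E; apply: val_inj => /=.
  have Em : nth false m i = nth false m j by rewrite -!block // E.
  by case: (ltngtP i j) => // lt; have := fmono _ _ lt (ltn_ord _); rewrite Em E ltnn => /(_ erefl).
(* [g] sends positions to letters, so the shuffle itself is the inverse of its permutation. *)
exists (perm g_inj)^-1%g; last first.
  apply: (@eq_from_nth _ false); rewrite size_shmask ?sz // => i lt.
  by rewrite (nth_shmask _ (Ordinal lt)) invgK permE /= block.
apply/forallP => x; apply/forallP => y; apply/implyP.
have [i ->] : exists i, x = perm g_inj i.
  by exists ((perm g_inj)^-1%g x); rewrite permKV.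
have [j ->] : exists j, y = perm g_inj j.
  by exists ((perm g_inj)^-1%g y); rewrite permKV.
rewrite !permK !permE /= => /andP[lt blk].
have Em : nth false m i = nth false m j.
  by rewrite -!block //; lia.
case: (ltngtP i j) => // [gt|E].
  by have := fmono _ _ gt (ltn_ord _); rewrite Em => /(_ erefl); lia.
by move: lt; rewrite E ltnn.
Qed.

(** Both lists are duplicate-free with the same members, by injectivity and surjectivity of [shmask]
    on shuffles. The predicate [Q] later prescribes the end bits. *)
Lemma perm_shmask (Q : pred bitseq) :
  perm_eq [seq shmask s | s in [pred s | is_shuffle s && Q (shmask s)]]
    [seq m <- masks (p + q) q | Q m].
Proof.
apply: uniq_perm; last 1 first.
- move=> m; rewrite mem_filter mem_masks; apply/imageP/idP.
    by case=> s /andP[_ Qs] ->; rewrite Qs size_shmask count_shmask !eqxx.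
  case/and3P => Qm /eqP sz /eqP ct; have [s sh E] := shmask_onto sz ct.
  by exists s; rewrite ?inE ?sh E.
- rewrite map_inj_in_uniq ?enum_uniq // => s s'; rewrite !mem_enum !inE.
  by move=> /andP[sh _] /andP[sh' _]; apply: shmask_inj.
- by rewrite filter_uniq ?masks_uniq.
Qed.
End ShuffleMasks.

(** * Sums over shuffles rewritten as sums over masks *)

Section Words.
Variables (k : fieldType) (V : lmodType k).
Local Notation T := (talg V).

Lemma perm_word_interleave (u v : seq V) (s : 'S_(size u + size v)) : is_shuffle s ->
  perm_word s (u ++ v) = interleave (shmask s) u v.
Proof.
move=> sh; have ct := count_shmask s.
have ctN : count negb (shmask s) = size u by rewrite count_negb ct size_shmask addnK.
apply: (@eq_from_nth _ 0).
  by rewrite size_perm_word size_interleave ?size_shmask.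
move=> i; rewrite size_perm_word => lt.
rewrite nth_interleave ?size_shmask // (nth_map (Ordinal lt)) ?size_enum_ord //.
rewrite (nth_ord_enum _ (Ordinal lt)) shmask_inv //= nth_cat.
case E: nth; first by rewrite ltnNge leq_addr /= addKn.
rewrite ifT // -[X in (_ < X)%N]ctN -[X in (_ < count _ X)%N](cat_take_drop i) count_cat.
by rewrite (drop_nth false) ?size_shmask //= E; lia.
Qed.

Lemma perm_sum_masks (u v : seq V) (Q : pred bitseq) :
  perm_sum (fun s : 'S_(size u + size v) => is_shuffle s && Q (shmask s)) (u ++ v) =
  \sum_(m <- masks (size u + size v) (size v) | Q m) word (interleave m u v).
Proof.
rewrite -[RHS]big_filter -(perm_big _ (perm_shmask (size u) (size v) Q)) big_image.
apply: eq_big => //= s /andP[sh _]; by rewrite perm_word_interleave.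
Qed.

Lemma shuffle_wordE (u v : seq V) :
  shuffle_word u v =
  \sum_(m <- masks (size u + size v) (size v)) word (interleave m u v).
Proof.
rewrite -(perm_sum_masks u v xpredT); apply: eq_bigl => s.
by rewrite andbT.
Qed.

End Words.

(** * Linear maps out of a tensor product agree once they agree on pure tensors *)

Section TensorBilinear.
Variables (k : fieldType) (M N P : lmodType k).

HB.instance Definition _ :=
  bilinear_isBilinear.Build k M N (M ⊗ N) *:%R *:%R (@tpure k M N) (tpure_bilin M N).

Lemma tens_ext (f g : {linear M ⊗ N -> P}) :
  (forall x y, f (x ⊗t y) = g (x ⊗t y)) -> f =1 g.
Proof.
by move=> E; elim/tens_ind => [|x y u IH]; rewrite ?linear0 // !linearD E IH.
Qed.
End TensorBilinear.

(** * Concatenation, and associativity of the shuffle product by its recursion on first letters *)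

Section Products.
Variables (k : fieldType) (V : lmodType k).
Local Notation T := (talg V).
Implicit Types (u v w : seq V) (x y z : T) (a b c : V).

Definition tcat : T -> T -> T := wlift2 (fun u v => word (u ++ v)).

HB.instance Definition _ := bilinear_isBilinear.Build k T T T *:%R *:%R tcat
  (wlift2_bilin (@concat_word_multilinear k V)).

Lemma tcatE u v : tcat (word u) (word v) = word (u ++ v).
Proof. exact: (wlift2E _ _ (@concat_word_multilinear k V)). Qed.

Lemma tcatA x y z : tcat x (tcat y z) = tcat (tcat x y) z.
Proof.
elim/talg_ind: x => [|l u x IH]; rewrite ?linear0l // !linearPl /= IH; congr (_ *: _ + _).
elim/talg_ind: y {IH} => [|m v y IH]; rewrite ?(linear0l, linear0r) // !(linearPl, linearPr) /= IH.
congr (_ *: _ + _).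
elim/talg_ind: z {IH} => [|n w z IH]; rewrite ?linear0r // !linearPr /= IH.
by rewrite !tcatE catA.
Qed.

Lemma tcat1x x : tcat (word [::]) x = x.
Proof. by elim/talg_ind: x => [|l u x IH]; rewrite ?linear0r // linearPr /= tcatE IH. Qed.

Definition tcons a : T -> T := tcat (word [:: a]).
Fact tcons_linear a : linear (tcons a).
Proof. by move=> l x y; rewrite /tcons linearPr. Qed.
HB.instance Definition _ a := GRing.isLinear.Build k T T _ (tcons a) (tcons_linear a).

Lemma tconsE a u : tcons a (word u) = word (a :: u).
Proof. exact: tcatE. Qed.

Lemma tcons_cat a x y : tcat (tcons a x) y = tcons a (tcat x y).
Proof. by rewrite /tcons tcatA. Qed.

Definition shp x y : T := shuffle V (x ⊗t y).

Fact shp_bilin : bilin shp.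
Proof. by split=> [y|x] l x1 x2; rewrite /shp ?linearPl ?linearPr /= linearP. Qed.
HB.instance Definition _ := bilinear_isBilinear.Build k T T T *:%R *:%R shp shp_bilin.

Lemma shpE u v : shp (word u) (word v) = shuffle_word u v.
Proof. exact: shuffleE. Qed.

Lemma shuffle_word_nil v : shuffle_word [::] v = word v.
Proof. by rewrite shuffle_wordE masksnn big_seq1 interleave_true. Qed.

Lemma shuffle_word_nilr u : shuffle_word u [::] = word u.
Proof. by rewrite shuffle_wordE masks0 addn0 big_seq1 interleave_false. Qed.

(** The first bit of the mask tells which word supplies the first letter, and [masks] is defined by
    recursion on that bit. *)
Lemma shuffle_word_cons a u b v :
  shuffle_word (a :: u) (b :: v) =
  tcons a (shuffle_word u (b :: v)) + tcons b (shuffle_word (a :: u) v).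
Proof.
rewrite shuffle_wordE /= big_cat !big_map !shuffle_wordE !linear_sum /= -addSnnS.
by congr (_ + _); apply: eq_bigr => m _; rewrite tconsE.
Qed.

Lemma shp1x x : shp (word [::]) x = x.
Proof.
by elim/talg_ind: x => [|l u x IH]; rewrite ?linear0r // linearPr /= shpE shuffle_word_nil IH.
Qed.

Lemma shpx1 x : shp x (word [::]) = x.
Proof.
by elim/talg_ind: x => [|l u x IH]; rewrite ?linear0l // linearPl /= shpE shuffle_word_nilr IH.
Qed.

Lemma shp_cons a x b y :
  shp (tcons a x) (tcons b y) = tcons a (shp x (tcons b y)) + tcons b (shp (tcons a x) y).
Proof.
elim/talg_ind: x => [|l u x IH].
  by rewrite !(linear0, linear0l) addr0.
rewrite !(linearP, linearPl) /= IH addrACA -scalerDr; congr (_ *: _ + _).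
elim/talg_ind: y {IH} => [|m v y IH].
  by rewrite !(linear0, linear0r) addr0.
rewrite !(linearP, linearPr) /= IH addrACA -scalerDr; congr (_ *: _ + _).
by rewrite !tconsE !shpE shuffle_word_cons.
Qed.

(** The three terms correspond to the possible first letters. The two terms starting with a, one for
    each first letter of Y ⧢ Z, recombine into one by [shp_cons]. *)
Lemma shp_cons_shp a x b y c z (X := tcons a x) (Y := tcons b y) (Z := tcons c z) :
  shp X (shp Y Z) =
    tcons a (shp x (shp Y Z)) + tcons b (shp X (shp y Z)) + tcons c (shp X (shp Y z)).
Proof.
rewrite /X /Y /Z (shp_cons b) !linearDr /= !(shp_cons a) linearD /=.
by rewrite [LHS]addrACA addrA.
Qed.

Lemma shp_shp_cons a x b y c z (X := tcons a x) (Y := tcons b y) (Z := tcons c z) :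
  shp (shp X Y) Z =
    tcons a (shp (shp x Y) Z) + tcons b (shp (shp X y) Z) + tcons c (shp (shp X Y) z).
Proof.
rewrite /X /Y /Z (shp_cons a) !linearDl /= !(shp_cons _ _ c) linearD /=.
by rewrite [LHS]addrACA.
Qed.

Lemma shpA x y z : shp x (shp y z) = shp (shp x y) z.
Proof.
(* Each of the three terms shortens a different word, so the induction is on a bound for the total
   length. *)
have W n u v w : (size u + size v + size w < n)%N ->
    shp (word u) (shp (word v) (word w)) = shp (shp (word u) (word v)) (word w).
  elim: n u v w => // n IH u v w.
  case: u => [|a u]; first by rewrite !shp1x.
  case: v => [|b v]; first by rewrite shpx1 shp1x.
  case: w => [|c w]; first by rewrite !shpx1.
  rewrite /= => lt; have IH1 := IH u (b :: v) (c :: w).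
  have IH2 := IH (a :: u) v (c :: w); have IH3 := IH (a :: u) (b :: v) w.
  rewrite -!tconsE in IH1 IH2 IH3 *.
  rewrite shp_cons_shp shp_shp_cons IH1 ?IH2 ?IH3 //; rewrite /=; lia.
elim/talg_ind: x => [|l u x IH]; rewrite ?linear0l // !linearPl /= IH; congr (_ *: _ + _).
elim/talg_ind: y {IH} => [|m v y IH]; rewrite ?(linear0l, linear0r) // !(linearPl, linearPr) /= IH.
congr (_ *: _ + _).
elim/talg_ind: z {IH} => [|n w z IH]; rewrite ?linear0r // !linearPr /= IH.
by rewrite (W (size u + size v + size w).+1).
Qed.

End Products.

(** * Equality of linear maps checked on generators *)

Section Extensionality.
Variables (k : fieldType) (P : lmodType k).

Let linear_at0 (M : lmodType k) (f : M -> P) : linear f -> f 0 = 0.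
Proof. by move=> fL; have := fL (-1) 0 0; rewrite scaler0 addr0 scaleN1r addNr. Qed.

(** Linearity is a proposition on plain functions here, so that the lemma applies to an equation
    between expressions in one generalised variable. *)
Lemma tens_eq (M N : lmodType k) (f g : M ⊗ N -> P) : linear f -> linear g ->
  (forall x y, f (x ⊗t y) = g (x ⊗t y)) -> f =1 g.
Proof.
move=> fL gL E; elim/tens_ind => [|x y u IH]; first by rewrite !linear_at0.
by rewrite -[x ⊗t y]scale1r fL gL E IH.
Qed.

Lemma talg_eq (V : lmodType k) (f g : talg V -> P) : linear f -> linear g ->
  (forall s, f (word s) = g (word s)) -> f =1 g.
Proof.
move=> fL gL E; elim/talg_ind => [|a s u IH]; first by rewrite !linear_at0.
by rewrite fL gL E IH.
Qed.

(** Induction on the span of nonempty words; at each step the word and the remainder are lifted to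
    [tpos] with their membership proofs. *)
Lemma tpos_eq (V : lmodType k) (f g : tpos V -> P) : linear f -> linear g ->
  (forall s t, s != [::] -> val t = word s -> f t = g t) -> f =1 g.
Proof.
move=> fL gL E; have H v : lspan (tpos_gen (V := V)) v -> forall t, val t = v -> f t = g t.
  elim=> [t Et|a _ u [s s0 ->] Su IH t Et].
    by rewrite (_ : t = 0) ?linear_at0 //; apply: val_inj.
  have uP : u \in in_lspan (tpos_gen (V := V)) by apply/in_lspanP.
  pose ts : tpos V := Sub (word s) (word_pos s0); pose tu : tpos V := Sub u uP.
  have -> : t = a *: ts + tu by apply: val_inj.
  by rewrite fL gL (IH tu) // (E s ts).
by move=> t; apply: (H (val t)) => //; apply/in_lspanP/valP.
Qed.
End Extensionality.

(** * The shuffle bialgebra *)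

Section Bialgebra.
Variables (k : fieldType) (V : lmodType k).
Local Notation T := (talg V).
Local Notation one := (word ([::] : seq V)).
Implicit Types (u v w : seq V) (x y z : T) (a b c : V) (X Y : T ⊗ T).

(** This and the following lemmas state linearity with a fixed head, so that rewriting acts on one
    chosen operation. *)
Lemma tpurePl (M N : lmodType k) l (x x' : M) (y : N) :
  (l *: x + x') ⊗t y = l *: (x ⊗t y) + x' ⊗t y.
Proof. exact: tpurel. Qed.
Lemma tpurePr (M N : lmodType k) l (x : M) (y y' : N) :
  x ⊗t (l *: y + y') = l *: (x ⊗t y) + x ⊗t y'.
Proof. exact: tpurer. Qed.
Lemma tpureDl (M N : lmodType k) (x x' : M) (y : N) :
  (x + x') ⊗t y = x ⊗t y + x' ⊗t y.
Proof. exact: linearDl. Qed.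
Lemma tpureDr (M N : lmodType k) (x : M) (y y' : N) :
  x ⊗t (y + y') = x ⊗t y + x ⊗t y'.
Proof. exact: linearDr. Qed.
Lemma tconsP a l x y : tcons a (l *: x + y) = l *: tcons a x + tcons a y.
Proof. exact: linearP. Qed.
Lemma tconsD a x y : tcons a (x + y) = tcons a x + tcons a y.
Proof. exact: linearD. Qed.
Lemma tconsZ a l x : tcons a (l *: x) = l *: tcons a x.
Proof. exact: linearZ. Qed.
Lemma shpPl l x y z : shp (l *: x + y) z = l *: shp x z + shp y z.
Proof. exact: linearPl. Qed.
Lemma shpPr l x y z : shp x (l *: y + z) = l *: shp x y + shp x z.
Proof. exact: linearPr. Qed.
Lemma tcatPl l x y z : tcat (l *: x + y) z = l *: tcat x z + tcat y z.
Proof. exact: linearPl. Qed.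
Lemma tcatPr l x y z : tcat x (l *: y + z) = l *: tcat x y + tcat x z.
Proof. exact: linearPr. Qed.
Lemma deconcP l x y : deconc V (l *: x + y) = l *: deconc V x + deconc V y.
Proof. exact: linearP. Qed.
Lemma deconcD x y : deconc V (x + y) = deconc V x + deconc V y.
Proof. exact: linearD. Qed.

Definition tcons1 (M : lmodType k) a : T ⊗ M -> T ⊗ M := tmap (tcons a) (@idfun M).
HB.instance Definition _ (M : lmodType k) a := GRing.Linear.on (@tcons1 M a).

Lemma tcons1P (M : lmodType k) a l (X Y : T ⊗ M) :
  tcons1 a (l *: X + Y) = l *: tcons1 a X + tcons1 a Y.
Proof. exact: linearP. Qed.
Lemma tcons1D (M : lmodType k) a (X Y : T ⊗ M) :
  tcons1 a (X + Y) = tcons1 a X + tcons1 a Y.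
Proof. exact: linearD. Qed.

Lemma tcons1E (M : lmodType k) a x (y : M) : tcons1 a (x ⊗t y) = tcons a x ⊗t y.
Proof. exact: tmapE. Qed.

Lemma deconc_nil : deconc V one = one ⊗t one.
Proof. by rewrite deconcE /deconc_word big_ord1. Qed.

(** Either the cut precedes the letter a, or a stays in the prefix. *)
Lemma deconc_cons a x : deconc V (tcons a x) = one ⊗t tcons a x + tcons1 a (deconc V x).
Proof.
move: x; apply: talg_eq => [l x y|l x y|u]; first by rewrite tconsP deconcP.
  by rewrite tconsP tpurePr deconcP tcons1P addrACA -scalerDr.
rewrite tconsE !deconcE /deconc_word /= big_ord_recl linear_sum; congr (_ + _).
by apply: eq_bigr => i _ /=; rewrite tcons1E tconsE.
Qed.

(** The product of the algebra T ⊗ T, factor by factor the shuffle. *)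
Definition tstar X Y : T ⊗ T := tmap (shuffle V) (shuffle V) (tau23 T T T T (X ⊗t Y)).

Lemma tstarPl l X Y Z : tstar (l *: X + Y) Z = l *: tstar X Z + tstar Y Z.
Proof. by rewrite /tstar tpurePl linearP; apply: linearP. Qed.
Lemma tstarPr l X Y Z : tstar X (l *: Y + Z) = l *: tstar X Y + tstar X Z.
Proof. by rewrite /tstar tpurePr linearP; apply: linearP. Qed.
Lemma tstarDl X Y Z : tstar (X + Y) Z = tstar X Z + tstar Y Z.
Proof. by rewrite -[X]scale1r tstarPl !scale1r. Qed.
Lemma tstarDr X Y Z : tstar X (Y + Z) = tstar X Y + tstar X Z.
Proof. by rewrite -[Y]scale1r tstarPr !scale1r. Qed.

Lemma tstarE x y z t : tstar (x ⊗t y) (z ⊗t t) = shp x z ⊗t shp y t.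
Proof. by rewrite /tstar tau23E; apply: tmapE. Qed.

Lemma tstar_cons a X b Y :
  tstar (tcons1 a X) (tcons1 b Y) =
  tcons1 a (tstar X (tcons1 b Y)) + tcons1 b (tstar (tcons1 a X) Y).
Proof.
move: X; apply: tens_eq => [l X X'|l X X'|x y]; first by rewrite tcons1P tstarPl.
  by rewrite !(tcons1P, tstarPl) addrACA -scalerDr.
move: Y; apply: tens_eq => [l X X'|l X X'|z t]; first by rewrite tcons1P tstarPr.
  by rewrite !(tcons1P, tstarPr) addrACA -scalerDr.
by rewrite !tcons1E !tstarE !tcons1E shp_cons tpureDl.
Qed.

Lemma tstar_1cons x b Y : tstar (one ⊗t x) (tcons1 b Y) = tcons1 b (tstar (one ⊗t x) Y).
Proof.
move: Y; apply: tens_eq => [l X X'|l X X'|z t]; rewrite ?(tcons1P, tstarPr) //.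
by rewrite tcons1E !tstarE tcons1E !shp1x.
Qed.

Lemma tstar_cons1 x a X : tstar (tcons1 a X) (one ⊗t x) = tcons1 a (tstar X (one ⊗t x)).
Proof.
move: X; apply: tens_eq => [l X X'|l X X'|z t]; rewrite ?(tcons1P, tstarPl) //.
by rewrite tcons1E !tstarE tcons1E !shpx1.
Qed.

Lemma tstar1X X : tstar (one ⊗t one) X = X.
Proof.
move: X; apply: tens_eq => [l X X'|//|z t]; first by rewrite tstarPr.
by rewrite tstarE !shp1x.
Qed.

Lemma tstarX1 X : tstar X (one ⊗t one) = X.
Proof.
move: X; apply: tens_eq => [l X X'|//|z t]; first by rewrite tstarPl.
by rewrite tstarE !shpx1.
Qed.

(** On words, both sides obey the same recursion: the terms with empty prefix give 1 ⊗ (x ⧢ y), and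
    in the others the first letter of the prefix comes from x or from y. *)
Lemma deconc_shp x y : deconc V (shp x y) = tstar (deconc V x) (deconc V y).
Proof.
move: x; apply: talg_eq => [l x x'|l x x'|u].
- by rewrite shpPl deconcP.
- by rewrite deconcP tstarPl.
move: y; apply: talg_eq => [l x x'|l x x'|v].
- by rewrite shpPr deconcP.
- by rewrite deconcP tstarPr.
elim: u v => [|a u IHu] v; first by rewrite shp1x deconc_nil tstar1X.
elim: v => [|b v IHv]; first by rewrite shpx1 deconc_nil tstarX1.
have {}IHu := IHu (b :: v); rewrite -!tconsE in IHu IHv *.
rewrite shp_cons deconcD !deconc_cons IHu IHv !deconc_cons.
(* The two terms with empty prefix recombine into the shuffle of the full words, matching the
   product of the two empty-prefix terms on the right. *)
rewrite addrACA -tpureDr -shp_cons !(tstarDl, tstarDr) tstarE shp1x -!addrA.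
rewrite tstar_1cons tstar_cons1 tstar_cons !tcons1D; congr (_ + _).
by rewrite [LHS]addrCA -[X in _ + X = _]addrA.
Qed.

Definition deconcl := tmap (deconc V) (@idfun T) : T ⊗ T -> (T ⊗ T) ⊗ T.
Definition deconcr := tmap (@idfun T) (deconc V) : T ⊗ T -> T ⊗ (T ⊗ T).
Lemma deconclP l X Y : deconcl (l *: X + Y) = l *: deconcl X + deconcl Y.
Proof. exact: linearP. Qed.
Lemma deconcrP l X Y : deconcr (l *: X + Y) = l *: deconcr X + deconcr Y.
Proof. exact: linearP. Qed.
Lemma deconclD X Y : deconcl (X + Y) = deconcl X + deconcl Y.
Proof. exact: linearD. Qed.
Lemma deconcrD X Y : deconcr (X + Y) = deconcr X + deconcr Y.
Proof. exact: linearD. Qed.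
Lemma deconclE x y : deconcl (x ⊗t y) = deconc V x ⊗t y.
Proof. exact: tmapE. Qed.
Lemma deconcrE x y : deconcr (x ⊗t y) = x ⊗t deconc V y.
Proof. exact: tmapE. Qed.
Lemma tassocP l (X Y : (T ⊗ T) ⊗ T) :
  tassoc T T T (l *: X + Y) = l *: tassoc T T T X + tassoc T T T Y.
Proof. exact: linearP. Qed.
Lemma tassocD (X Y : (T ⊗ T) ⊗ T) :
  tassoc T T T (X + Y) = tassoc T T T X + tassoc T T T Y.
Proof. exact: linearD. Qed.

Lemma deconc_coassoc x :
  tassoc T T T (tmap (deconc V) (@idfun T) (deconc V x)) =
  tmap (@idfun T) (deconc V) (deconc V x).
Proof.
rewrite -/deconcl -/deconcr; move: x; apply: talg_eq => [l x y|l x y|u].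
- by rewrite deconcP deconclP tassocP.
- by rewrite deconcP deconcrP.
have E1 a X : tassoc T T T (deconcl (tcons1 a X)) =
    one ⊗t tcons1 a X + tcons1 a (tassoc T T T (deconcl X)).
  (* The extra term comes from cutting the prefix before its first letter. *)
  move: X; apply: tens_eq => [l X Y|l X Y|x y]; first by rewrite tcons1P deconclP tassocP.
    by rewrite tcons1P tpurePr deconclP tassocP tcons1P addrACA -scalerDr.
  rewrite tcons1E !deconclE deconc_cons tpureDl tassocD tassocE.
  congr (_ + _); move: (deconc V x).
  apply: tens_eq => [l X Y|l X Y|z t]; first by rewrite tcons1P tpurePl tassocP.
    by rewrite tpurePl tassocP tcons1P.
  by rewrite tcons1E !tassocE tcons1E.
have E2 a X : deconcr (tcons1 a X) = tcons1 a (deconcr X).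
  move: X; apply: tens_eq => [l X Y|l X Y|x y].
  - by rewrite tcons1P deconcrP.
  - by rewrite deconcrP tcons1P.
  by rewrite tcons1E !deconcrE tcons1E.
elim: u => [|a u IH].
  by rewrite deconc_nil deconclE deconcrE deconc_nil tassocE.
rewrite -tconsE deconc_cons deconclD tassocD deconcrD deconclE deconcrE.
by rewrite deconc_nil tassocE E1 E2 IH deconc_cons tpureDr -addrA.
Qed.

Fact nilp_multilinear : multilinear (fun u => (nilp u)%:R : k^o).
Proof. by move=> [|d s] t l a b; rewrite scaler0 addr0. Qed.

(** The coefficient of the empty word. *)
Definition counit : T -> k := wlift (fun u => (nilp u)%:R : k^o).

Lemma counitP l x y : counit (l *: x + y) = l * counit x + counit y.
Proof. exact: (wlift_linear nilp_multilinear). Qed.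
HB.instance Definition _ := GRing.isLinear.Build k T k _ counit counitP.

Lemma counit1 : counit one = 1.
Proof. exact: wliftE nilp_multilinear _. Qed.

Lemma counit_cons a x : counit (tcons a x) = 0.
Proof.
move: x; apply: (talg_eq (P := k^o)) => [l x y|l x y|u]; first by rewrite tconsP counitP.
  by rewrite scaler0 addr0.
by rewrite tconsE; apply: wliftE nilp_multilinear _.
Qed.

Lemma counit_shp x y : counit (shp x y) = counit x * counit y.
Proof.
move: x; apply: (talg_eq (P := k^o)) => [l x x'|l x x'|u]; first by rewrite shpPl counitP.
  by rewrite counitP mulrDl -mulrA.
move: y; apply: (talg_eq (P := k^o)) => [l x x'|l x x'|v]; first by rewrite shpPr counitP.
  by rewrite counitP mulrDr mulrCA.
case: u v => [|a u] v; first by rewrite shp1x counit1 mul1r.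
case: v => [|b v]; first by rewrite shpx1 counit1 mulr1.
by rewrite -!tconsE shp_cons -[tcons a (shp _ _)]scale1r counitP !counit_cons mul0r mulr0 addr0.
Qed.

Fact counitl_bilin : bilin (fun x y : T => counit x *: y).
Proof.
split=> [y|x] l z t; first by rewrite counitP scalerDl scalerA.
by rewrite scalerDr !scalerA mulrC.
Qed.

Fact counitr_bilin : bilin (fun x y : T => counit y *: x).
Proof.
split=> [y|x] l z t; last by rewrite counitP scalerDl scalerA.
by rewrite scalerDr !scalerA mulrC.
Qed.

Lemma counit_deconcl x : tlift (fun x y : T => counit x *: y) (deconc V x) = x.
Proof.
have tP := tlift_linear counitl_bilin; have tE := tliftE counitl_bilin.
(* Nonempty prefixes are killed, so only the cut before the first letter survives. *)
have tcons0 a X : tlift (fun x y : T => counit x *: y) (tcons1 a X) = 0.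
  move: X; apply: tens_eq => [l X Y|l X Y|z t]; first by rewrite tcons1P tP.
    by rewrite scaler0 addr0.
  by rewrite tcons1E tE counit_cons scale0r.
move: x; apply: talg_eq => [l x y|//|[|a u]]; first by rewrite deconcP tP.
  by rewrite deconc_nil tE counit1 scale1r.
by rewrite -tconsE deconc_cons -[one ⊗t _]scale1r tP tE counit1 !scale1r tcons0 addr0.
Qed.

Lemma counit_deconcr x : tlift (fun x y : T => counit y *: x) (deconc V x) = x.
Proof.
have tP := tlift_linear counitr_bilin; have tE := tliftE counitr_bilin.
(* The counit acts on the suffix, so it commutes with prepending to the prefix; by induction only
   the cut at the end survives. *)
have tconsC a X : tlift (fun x y : T => counit y *: x) (tcons1 a X) =
    tcons a (tlift (fun x y : T => counit y *: x) X).
  move: X; apply: tens_eq => [l X Y|l X Y|z t]; first by rewrite tcons1P tP.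
    by rewrite tP tconsP.
  by rewrite tcons1E !tE tconsZ.
move: x; apply: talg_eq => [l x y|//|]; first by rewrite deconcP tP.
elim=> [|a u IH]; first by rewrite deconc_nil tE counit1 scale1r.
rewrite -tconsE deconc_cons -[one ⊗t _]scale1r tP tE counit_cons scale0r scaler0 add0r.
by rewrite tconsC IH.
Qed.

Lemma shuffle_bialgebra : is_bialgebra (shuffle V) one (deconc V).
Proof.
split.
- exact: shpA.
- exact: shp1x.
- exact: shpx1.
- exact: deconc_coassoc.
- exists counit; split.
  + exact: counit_deconcl.
  + exact: counit_deconcr.
  + exact: counit1.
  + exact: counit_shp.
- exact: deconc_nil.
apply: tens_ext => x y; rewrite [LHS]/= [RHS]/= tmapE; exact: deconc_shp.
Qed.

(** * Cutting a shuffle at a marked letter *)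

Definition split_shp y c z : T ⊗ T -> T :=
  tlift (fun p q => tcat (shp p y) (tcons c (shp q z))).

Fact split_bilin y c z : bilin (fun p q => tcat (shp p y) (tcons c (shp q z))).
Proof.
split=> [q|p] l s t; first by rewrite shpPl tcatPl.
by rewrite shpPl tconsP tcatPr.
Qed.

Lemma split_shpP y c z l X Y :
  split_shp y c z (l *: X + Y) = l *: split_shp y c z X + split_shp y c z Y.
Proof. exact: tlift_linear (split_bilin y c z) _ _ _. Qed.

Lemma split_shpD y c z X Y :
  split_shp y c z (X + Y) = split_shp y c z X + split_shp y c z Y.
Proof. by rewrite -[X]scale1r split_shpP !scale1r. Qed.

Lemma split_shpE y c z p q :
  split_shp y c z (p ⊗t q) = tcat (shp p y) (tcons c (shp q z)).
Proof. exact: (tliftE (split_bilin y c z)). Qed.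

Lemma split_shp_nil c z a X : split_shp one c z (tcons1 a X) = tcons a (split_shp one c z X).
Proof.
move: X; apply: tens_eq => [l X Y|l X Y|p q]; first by rewrite tcons1P split_shpP.
  by rewrite split_shpP tconsP.
by rewrite tcons1E !split_shpE !shpx1 tcons_cat.
Qed.

(** The marked letter c lies to the right of b, so the first letter is a or b, as in the recursion
    for the shuffle of the prefixes. *)
Lemma split_shp_cons b y c z a X :
  split_shp (tcons b y) c z (tcons1 a X) =
  tcons a (split_shp (tcons b y) c z X) + tcons b (split_shp y c z (tcons1 a X)).
Proof.
move: X; apply: tens_eq => [l X Y|l X Y|p q]; first by rewrite tcons1P split_shpP.
  by rewrite tcons1P !split_shpP !tconsP addrACA -scalerDr.
rewrite tcons1E !split_shpE shp_cons.
by rewrite -[tcons a (shp _ _)]scale1r tcatPl !scale1r !tcons_cat.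
Qed.

(* Shuffling x into y c z cuts x at the position of the letter c. *)
Lemma shp_split x y c z : shp x (tcat y (tcons c z)) = split_shp y c z (deconc V x).
Proof.
move: x; apply: talg_eq => [l x x'|l x x'|u]; first by rewrite shpPl.
  by rewrite deconcP split_shpP.
(* Linearity in y is what allows y to be taken to be a word. *)
have splitPl X : linear (fun y => split_shp y c z X).
  move=> l x x'; move: X; apply: tens_eq => [m X Y|m X Y|p q].
  - by rewrite split_shpP.
  - by rewrite !split_shpP !scalerDr !scalerA (mulrC l) addrACA.
  by rewrite !split_shpE shpPr tcatPl.
move: y; apply: talg_eq => [l x x'|//|v]; first by rewrite tcatPl shpPr.
elim: u v => [|a u IHu] v.
  by rewrite deconc_nil split_shpE !shp1x.
(* Sorting by first letter: a leads to the outer induction, at the same v; b leads to the inner one;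
   when v is empty, c gives the cut of x with empty prefix. *)
rewrite -tconsE; elim: v => [|b v IHv].
  rewrite tcat1x shp_cons deconc_cons split_shpD split_shpE shp1x tcat1x addrC.
  by rewrite split_shp_nil -IHu tcat1x.
rewrite -tconsE tcons_cat shp_cons IHv -tcons_cat tconsE IHu -tconsE.
rewrite deconc_cons !split_shpD split_shp_cons tconsD addrCA; congr (_ + _).
by rewrite !split_shpE !shp1x tcons_cat.
Qed.

End Bialgebra.

(** * The quadri-algebra operations as sums over masks with prescribed end bits *)

(** [masks] recurses on the first bit, so fixing the last one gives the same masks only up to
    order. *)
Lemma masks_rcons n q :
  perm_eq [seq m <- masks n.+1 q.+1 | last false m] [seq rcons m true | m <- masks n q].
Proof.
apply: uniq_perm.
- by rewrite filter_uniq ?masks_uniq.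
- by rewrite map_inj_uniq ?masks_uniq // => m m' /rcons_inj[].
move=> m; rewrite mem_filter mem_masks; apply/idP/mapP.
  case/lastP: m => // m b; rewrite last_rcons => /and3P[->].
  rewrite size_rcons eqSS -cats1 count_cat /= addn1 eqSS => sz ct.
  by exists m; rewrite ?cats1 // mem_masks sz.
case=> m' /[!mem_masks] /andP[/eqP sz /eqP ct] ->.
by rewrite last_rcons size_rcons sz -cats1 count_cat ct /= addn1 !eqxx.
Qed.

Lemma nth_last_bit (m : bitseq) n : size m = n -> nth false m n.-1 = last false m.
Proof. by move=> <-; rewrite nth_last. Qed.

Section QuadMasks.
Variables p q : nat.
Hypotheses (p_gt0 : (0 < p)%N) (q_gt0 : (0 < q)%N).
Implicit Types (s : 'S_(p + q)).

(** The first position holds letter [p] or letter 0 according to its bit, and these differ as [p] is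
    positive. *)
Lemma inv_sends_first s fv : is_shuffle s ->
  inv_sends s 0 (if fv then p else 0%N) = (nth false (shmask s) 0 == fv).
Proof.
move=> sh; have lt : (0 < p + q)%N by rewrite addn_gt0 p_gt0.
transitivity (((s^-1)%g (Ordinal lt) : nat) == if fv then p else 0%N).
  apply/existsP/idP => [[a /andP[/eqP a0]]|E]; last by exists (Ordinal lt); rewrite E.
  by rewrite (_ : a = Ordinal lt) //; apply: val_inj.
rewrite shmask_inv //= take0 /=.
by case: nth fv => [] []; rewrite ?addn0 ?eqxx // ?(eq_sym 0%N) -?lt0n ?p_gt0 // gtn_eqF.
Qed.

Lemma inv_sends_last s lv : is_shuffle s ->
  inv_sends s (p + q).-1 (if lv then (p + q).-1 else p.-1) =
  (last false (shmask s) == lv).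
Proof.
move=> sh; have lt : ((p + q).-1 < p + q)%N by lia.
transitivity (((s^-1)%g (Ordinal lt) : nat) == if lv then (p + q).-1 else p.-1).
  apply/existsP/idP => [[a /andP[/eqP a0]]|E].
    by rewrite (_ : a = Ordinal lt) //; apply: val_inj.
  by exists (Ordinal lt); rewrite E eqxx.
have sz := size_shmask s; have ct := count_shmask s.
have ctN : count negb (shmask s) = p by rewrite count_negb; lia.
rewrite shmask_inv //= nth_last_bit //.
move: sz ct ctN; case/lastP: (shmask s) => [|m b]; first by rewrite /=; lia.
rewrite size_rcons last_rcons -cats1 !count_cat /= => sz ct ctN.
(* The last letter is the last of its block, number [(p + q).-1] or [p.-1]; these differ as [q] is
   positive. *)
rewrite -sz /= take_size_cat //; case: b lv ct ctN => [] [] /= ct ctN; lia.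
Qed.

Lemma quad_shuffleE fv lv s :
  quad_shuffle fv lv s =
  is_shuffle s && ((nth false (shmask s) 0 == fv) && (last false (shmask s) == lv)).
Proof.
rewrite /quad_shuffle; case sh: is_shuffle => //=.
by rewrite inv_sends_first // inv_sends_last.
Qed.
End QuadMasks.

Section QuadWords.
Variables (k : fieldType) (V : lmodType k).
Local Notation T := (talg V).
Implicit Types (u v : seq V).

Lemma quad_wordE fv lv u v : u != [::] -> v != [::] ->
  quad_word fv lv u v =
  \sum_(m <- masks (size u + size v) (size v) |
      (nth false m 0 == fv) && (last false m == lv)) word (interleave m u v).
Proof.
rewrite -!size_eq0 => u0 v0.
rewrite /quad_word /nilp (negPf u0) (negPf v0) /= -perm_sum_masks.
by apply: eq_bigl => s; rewrite quad_shuffleE ?lt0n.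
Qed.

(** Summing over both values of the first bit leaves only the condition that the last bit is set;
    removing that bit leaves an arbitrary mask for u and v. *)
Lemma vee_word u v b :
  quad_word true true u (rcons v b) + quad_word false true u (rcons v b) =
  tcat (shuffle_word u v) (word [:: b]).
Proof.
have v0 : rcons v b != [::] by case: v.
(* For empty u the unit conventions apply: ↘ returns the second word and ↙ vanishes. *)
case: (altP (u =P [::])) => [->|u0].
  by rewrite shuffle_word_nil tcatE cats1 /quad_word /= /nilp size_rcons /= addr0.
rewrite !quad_wordE //.
transitivity (\sum_(m <- masks (size u + size (rcons v b)) (size (rcons v b)) |
    last false m) word (interleave m u (rcons v b))).
  rewrite [RHS](bigID (fun m => nth false m 0)) /=; congr (_ + _); apply: eq_bigl => m.
    by rewrite !eqb_id andbC.
  by rewrite eqb_id eqbF_neg andbC.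
rewrite -big_filter size_rcons addnS (perm_big _ (masks_rcons _ _)) big_map.
rewrite shuffle_wordE linear_sumlz /=; apply: eq_big_seq => m.
rewrite mem_masks => /andP[/eqP sz /eqP ct].
by rewrite interleave_rcons // ?tcatE ?cats1 // count_negb sz ct addnK.
Qed.

Lemma succ_word u b v :
  quad_word true false u (b :: v) + quad_word true true u (b :: v) =
  tcons b (shuffle_word u v).
Proof.
case: u => [|a u]; first by rewrite shuffle_word_nil tconsE /quad_word /= add0r.
rewrite !quad_wordE // shuffle_wordE linear_sum.
transitivity (\sum_(m <- masks (size (a :: u) + size (b :: v)) (size (b :: v)) |
    nth false m 0) word (interleave m (a :: u) (b :: v))).
  rewrite [RHS](bigID (last false)) [RHS]addrC /=.
  congr (_ + _); apply: eq_bigl => m; first by rewrite eqb_id eqbF_neg.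
  by rewrite !eqb_id.
(* The masks with first bit unset are excluded; the others are a set bit followed by an arbitrary
   mask. *)
rewrite /= big_cat !big_map /= big_pred0 // add0r -addSnnS.
by apply: eq_bigr => m _; rewrite tconsE.
Qed.

End QuadWords.

(** * The two module-algebra structures *)

Section ModuleAlgebras.
Variables (k : fieldType) (V : lmodType k).
Local Notation T := (talg V).
Local Notation Tp := (tpos V).

Lemma val_concat (y z : Tp) : val (concat V (y ⊗t z)) = tcat (val y) (val z).
Proof. by rewrite /concat (tliftE (concat_bilin V)). Qed.

(* [ins] adjoins a letter at a fixed end. *)
Lemma insertion_module_algebra (ins : V -> T -> T) (Phi : {linear T ⊗ Tp -> Tp}) :
    (forall v, v != [::] -> exists b s, word v = ins b (word s)) ->
    (forall b c, exists d e, forall y z,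
        tcat (ins b y) (ins c z) = ins d (tcat y (tcons e z))) ->
    (forall b, linear (ins b)) ->
    (forall x b y (t : Tp), val t = ins b y -> val (Phi (x ⊗t t)) = ins b (shp x y)) ->
  is_module_algebra (shuffle V) (word [::]) (deconc V) (concat V) Phi.
Proof.
move=> ins_word ins_cat insP PhiE.
have PhiP x l t t' : Phi (x ⊗t (l *: t + t')) = l *: Phi (x ⊗t t) + Phi (x ⊗t t').
  by rewrite tpurePr linearP.
split; first exact: shuffle_bialgebra.
- by move=> a b c; apply: val_inj; rewrite !val_concat tcatA.
- apply: tpos_eq => [l t t'|//|s t s0 Et]; first exact: PhiP.
  have [b [v Ev]] := ins_word _ s0.
  by apply: val_inj; rewrite (PhiE _ b (word v)) ?Et // shp1x -Ev.
- move=> x y; apply: tpos_eq => [l t t'|l t t'|s t s0 Et]; rewrite ?PhiP //.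
  have [b [v Ev]] := ins_word _ s0; have Eb : val t = ins b (word v) by rewrite Et.
  apply: val_inj; rewrite (PhiE _ _ _ _ Eb) (PhiE _ _ _ _ (PhiE _ _ _ _ Eb)).
  by congr (ins b _); rewrite shpA.
(* The right side of the compatibility, with Δ(x) replaced by a free tensor [X] so that linearity in
   it can be used. *)
pose F X (w : Tp ⊗ Tp) := concat V (tmap Phi Phi (tau23 T T Tp Tp (X ⊗t w))).
have FPl l X Y w : F (l *: X + Y) w = l *: F X w + F Y w.
  by rewrite /F tpurePl !linearP.
have FPr X l w w' : F X (l *: w + w') = l *: F X w + F X w'.
  by rewrite /F tpurePr !linearP.
have FE p q t t' : val (F (p ⊗t q) (t ⊗t t')) = tcat (val (Phi (p ⊗t t))) (val (Phi (q ⊗t t'))).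
  by rewrite /F tau23E tmapE val_concat.
apply: tens_ext => x w; rewrite [LHS]/= [RHS]/= !tmapE -[LHS]/(Phi (x ⊗t concat V w)) -[RHS]/(F (deconc V x) w).
move: w; apply: tens_eq => [l w w'|l w w'|t t'].
- by rewrite linearP PhiP.
- exact: FPr.
move: t; apply: tpos_eq => [l t1 t2|l t1 t2|s t s0 Et].
- by rewrite tpurePl linearP PhiP.
- by rewrite tpurePl FPr.
move: t'; apply: tpos_eq => [l t1 t2|l t1 t2|s' t' s0' Et'].
- by rewrite tpurePr linearP PhiP.
- by rewrite tpurePr FPr.
have [b [v Ev]] := ins_word _ s0; have [c [v' Ev']] := ins_word _ s0'.
have [d [e Ede]] := ins_cat b c; apply: val_inj.
rewrite Ev in Et; rewrite Ev' in Et'.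
rewrite (PhiE _ d (tcat (word v) (tcons e (word v')))); last first.
  by rewrite val_concat Et Et'.
(* Both sides are now linear in Δ(x), so pure tensors p ⊗ q suffice. *)
rewrite shp_split; move: (deconc V x).
apply: tens_eq => [l X Y|l X Y|p q].
- by rewrite split_shpP insP.
- by rewrite FPl linearP.
by rewrite FE (PhiE _ _ _ _ Et) (PhiE _ _ _ _ Et') Ede split_shpE.
Qed.

Lemma val_quad fv lv x (t : Tp) :
  val (quad fv lv (x ⊗t t)) = wlift2 (quad_word fv lv) x (val t).
Proof. by rewrite /quad (tliftE (pos_act_bilin (@quad_op k V fv lv))). Qed.

(** Both sides are linear in x and in y, so words suffice; the witness w presents the inserted word
    as a word, on which the operations are given by [quad_word]. *)
Lemma quad_sum_ins fv lv fv' lv' (ins : T -> T) : linear ins ->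
    (forall u v, exists2 w, ins (word v) = word w &
       quad_word fv lv u w + quad_word fv' lv' u w = ins (shuffle_word u v)) ->
  forall x y (t : Tp), val t = ins y ->
    val (quad fv lv (x ⊗t t) + quad fv' lv' (x ⊗t t)) = ins (shp x y).
Proof.
move=> insP quadE x y t Et; rewrite linearD /= !val_quad Et {t Et}.
have M := @quad_word_multilinear k V.
have [Bl Br] := wlift2_bilin (M fv lv); have [Bl' Br'] := wlift2_bilin (M fv' lv').
move: x; apply: talg_eq => [l x x'|l x x'|u].
- by rewrite Bl Bl' addrACA -scalerDr.
- by rewrite shpPl insP.
move: y; apply: talg_eq => [l x x'|l x x'|v].
- by rewrite insP Br Br' addrACA -scalerDr.
- by rewrite shpPr insP.
have [w -> E] := quadE u v.
by rewrite !wlift2E // shpE.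
Qed.

Lemma vee_module_algebra :
  is_module_algebra (shuffle V) (word [::]) (deconc V) (concat V) (vee V).
Proof.
apply: (@insertion_module_algebra (fun b y => tcat y (word [:: b]))).
- by case/lastP=> // v b _; exists b, v; rewrite tcatE cats1.
(* (y b)(z c) = (y b z) c: the letter c stays frozen at the end and b becomes the marked one. *)
- move=> b c; exists c, b => y z.
  by rewrite /tcons !tcatA.
- by move=> b l y z; rewrite tcatPl.
move=> x b y t Et.
rewrite -[vee V _]/(quad true true (x ⊗t t) + quad false true (x ⊗t t)).
apply: (quad_sum_ins (ins := fun y => tcat y (word [:: b])) _ _ _ Et) => [l z z'|u v].
  by rewrite tcatPl.
by exists (rcons v b); rewrite ?tcatE ?cats1 ?vee_word.
Qed.

Lemma succ_module_algebra :
  is_module_algebra (shuffle V) (word [::]) (deconc V) (concat V) (succ V).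
Proof.
apply: (@insertion_module_algebra (@tcons k V)).
- by case=> // b v _; exists b, v; rewrite tconsE.
(* (b y)(c z) = b (y c z): here b stays frozen and c is marked. *)
- by move=> b c; exists b, c => y z; rewrite tcons_cat.
- by move=> b l y z; rewrite tconsP.
move=> x b y t Et.
rewrite -[succ V _]/(quad true false (x ⊗t t) + quad true true (x ⊗t t)).
apply: (quad_sum_ins (ins := tcons b) _ _ _ Et) => [l z z'|u v].
  by rewrite tconsP.
by exists (b :: v); rewrite ?tconsE ?succ_word.
Qed.
End ModuleAlgebras.

Theorem theorem2 (k : fieldType) (V : lmodType k) :
  is_module_algebra (shuffle V) (word (V := V) [::]) (deconc V) (concat V) (vee V)
  /\ is_module_algebra (shuffle V) (word (V := V) [::]) (deconc V) (concat V) (succ V).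
Proof. by split; [exact: vee_module_algebra | exact: succ_module_algebra]. Qed.
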